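(* Let $X$ be a compact metrizable space, and let $C_1(X)=\{x\in X : \{x\}\text{ is a connected component of }X\}$ be the union of all $1$-point components of $X$. If $C_1(X)$ does not form a dense $G_\delta$ subset of $X$ of cardinality $\mathfrak{c}=2^{\aleph_0}$, then $X$ is reconstructible.
   Context: For a topological space $X$, $[Y]$ denotes the homeomorphism class of $Y$, and the deck of $X$ is the set $\mathcal{D}(X)=\{[X\setminus\{x\}] : x\in X\}$. The space $X$ is reconstructible if every topological space $Z$ with $\mathcal{D}(Z)=\mathcal{D}(X)$ is homeomorphic to $X$. A $G_\delta$ set is a countable intersection of open sets.
   Formalization: The formal theorem also assumes X does not have exactly two points; the two-point discrete space is a counterexample to the claim as written, since the Sierpinski space has the same deck but is not homeomorphic to it. *)

(* Defs.v *)
From HB Require Import structures.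
From mathcomp Require Import all_boot all_order all_algebra.
From mathcomp Require Import all_classical all_reals.
From mathcomp Require Import topology borel_hierarchy.

Set Implicit Arguments.
Unset Strict Implicit.
Unset Printing Implicit Defensive.

Local Open Scope classical_set_scope.

Definition homeomorphic (X Y : topologicalType) : Prop :=
  exists (f : X -> Y) (g : Y -> X),
    [/\ continuous f, continuous g, cancel f g & cancel g f].

Definition metrizable (R : realType) (X : topologicalType) : Prop :=
  exists M : metricType R, homeomorphic X M.

(* Written with plain predicates: [set topologicalType] is ruled out by the
   universe constraints of [set]. *)
Definition homeo_class (Y : topologicalType) : topologicalType -> Prop :=
  fun W => homeomorphic Y W.

(* [~` [set x]] is coerced to its [set_type], which carries the subspace
   topology (the initial topology of the inclusion). *)
Definition card_at (X : topologicalType) (x : X) : topologicalType :=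
  (~` [set x] : set X).

Definition deck (X : topologicalType) : (topologicalType -> Prop) -> Prop :=
  fun c => exists x : X, c = homeo_class (card_at x).

(* No separation axiom is imposed on Z. The discrete two-point space is then
   not reconstructible, since the Sierpinski space has the same deck (its only
   card is the one-point space). *)
Definition reconstructible (X : topologicalType) : Prop :=
  forall Z : topologicalType, deck Z = deck X -> homeomorphic Z X.

Definition C1 (X : topologicalType) : set X :=
  [set x | connected_component [set: X] x = [set x]].
Arguments C1 X : clear implicits.

(* Main.v *)
Require Import Defs.
From HB Require Import structures.
From mathcomp Require Import all_boot all_order all_algebra.
From mathcomp Require Import all_classical all_reals.
From mathcomp Require Import topology borel_hierarchy.

Set Implicit Arguments.
Unset Strict Implicit.
Unset Printing Implicit Defensive.

Local Open Scope classical_set_scope.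
Local Open Scope card_scope.

(** Let Z have the same deck as X. If X does not have exactly two points, Z
is Hausdorff: any two of its points survive in a Hausdorff card that misses
some third point. A homeomorphism between two cards extends to a bijection
X -> Z that is bicontinuous away from a single point. If Z is compact, then X
and Z are both the one-point compactification (or the sum with a point) of
the common card, so the bijection is a homeomorphism
([homeo_off_continuous]).

So suppose Z is not compact. Say that x splits into n parts when a punctured
neighbourhood of x can be coloured in a locally constant way with n of the
colours accumulating at x ([splits]). In the compact space X, the point x
stands both for the point z of Z that replaces it and for the missing point
at infinity of Z. If z splits into n parts, the complement of a compact
neighbourhood of z therefore contributes one more part at x
([splits_succ]). On the other hand, splitting is a local property and each
point of Z lies in the range of a partial homeomorphism with X. Hence, if all
points of X split into n parts, so do all points of Z, and then all points of
X split into n + 1 parts: every point of X splits into arbitrarily many parts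
([splits_of_not_reconstructible]). Already n = 1 excludes isolated points, and
only n = 3 is used beyond that.

The classical theorem that a separable continuum has at most countably many
cut points of order three or more now has a local counterpart: if every point
of X splits into three parts, then every nonempty open set V contains a
nonempty clopen set ([trisected_open_clopen]). Otherwise, around each x in V
there is a basic open set B such that, for each of three parts A_i at x, no
open piece of A_i inside B contains all of A_i near x and has x as its only
boundary point ([sprout], [small_nbhs_no_sprout]). The point x is then
determined by B together with the traces of the A_i on the boundary of
B: were y another point with the same data, y in A_j(x) and x in A_l(y), pick
i different from j and l; the set A_i(x) & A_l(y) & B is a piece of the
forbidden kind ([codes_inj]). Traces are recorded by finite unions of basic
open sets, so V would be countable, whereas nonempty open sets of a compact
Hausdorff space without isolated points contain Cantor schemes
([cantor_scheme]).

Finally, components and quasicomponents agree in compact Hausdorff spaces, so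
C1(X) is an intersection of countably many open sets, each described through
clopen sets ([C1_bigcap]). The abundance of clopen sets makes all of
them dense, and a Cantor scheme inside their intersection provides density of
C1(X) and a subset of cardinality continuum. *)

(** * Compact Hausdorff spaces *)

Lemma hausdorff_disjoint_open (T : topologicalType) (x y : T) :
  hausdorff_space T -> x <> y ->
  exists U V : set T, [/\ open U, open V, U x, V y & U `&` V = set0].
Proof.
rewrite open_hausdorff => hT /eqP/hT [[U V] /= [Ux Vy] [oU oV /eqP UV]].
by exists U, V; split=> //; exact: set_mem.
Qed.

Lemma hausdorff_closed1 (T : topologicalType) (x : T) :
  hausdorff_space T -> closed [set x].
Proof. by move=> hT; exact/accessible_closed_set1/hausdorff_accessible. Qed.

Lemma hausdorff_openC1 (T : topologicalType) (x : T) :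
  hausdorff_space T -> open (~` [set x]).
Proof. by move=> hT; apply/closed_openC/hausdorff_closed1. Qed.

Lemma compact_shrink (T : topologicalType) (x : T) (U : set T) :
  hausdorff_space T -> compact [set: T] -> nbhs x U ->
  exists V, [/\ open V, V x & closure V `<=` U].
Proof.
move=> hT cT Ux.
have [W Wx WU] := @compact_regular T x setT hT cT filterT U Ux.
exists (interior W); split; first exact: open_interior.
  exact: nbhs_singleton (nbhs_interior Wx).
by apply: subset_trans WU; apply: closureS; exact: interior_subset.
Qed.

(** The finite subfamilies of [D], directed by inclusion, generate a filter along
which the covering property holds near every point of [K], hence on [K]. *)
Lemma compact_finite_cover (T : topologicalType) (I : choiceType)
    (K : set T) (f : I -> set T) (D : set I) :
  compact K -> (forall i, open (f i)) -> K `<=` \bigcup_(i in D) f i ->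
  exists s : seq I, [set` s] `<=` D /\ K `<=` \bigcup_(i in [set` s]) f i.
Proof.
move=> /compact_near_coveringP cK of_ Kf.
pose F := filter_from [set s : seq I | [set` s] `<=` D]
  (fun s => [set t : seq I | {subset s <= t}]).
have FF : Filter F.
  apply: filter_from_filter; first by exists [::].
  move=> s t sD tD; exists (s ++ t) => [i /=|u /= stu].
    by rewrite mem_cat => /orP[/sD|/tD].
  by split=> i ist; apply: stu; rewrite mem_cat ist ?orbT.
have [x Kx|s sD /(_ s) Ks] := cK _ F (fun s x => exists2 i, i \in s & f i x) FF.
  have [i Di fix_] := Kf x Kx.
  exists (f i, [set t : seq I | {subset [:: i] <= t}]) => /=.
    split; first exact: open_nbhs_nbhs.
    by exists [:: i] => // j; rewrite /= inE => /eqP ->.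
  by move=> [y t] /= [fiy it]; exists i => //; apply: it; rewrite inE.
exists s; split=> // x Kx.
by have [i si fix_] := Ks (fun _ => id) x Kx; exists i.
Qed.

(** * Cantor schemes *)

(** A binary tree of open sets whose closures at level [n.+1] lie in [G n]. With
[G := fun=> setT] it makes nonempty open sets uncountable, and the mere
existence of a value of [F] is the Baire category theorem. *)
Lemma cantor_scheme (T : topologicalType) (G : nat -> set T) (V : set T) :
  hausdorff_space T -> compact [set: T] -> (forall x : T, ~ open [set x]) ->
  (forall n, open (G n)) -> (forall n, dense (G n)) ->
  open V -> V !=set0 ->
  exists F : (nat -> bool) -> T,
    injective F /\ forall a, V (F a) /\ forall n, G n (F a).
Proof.
move=> hT cT niso oG dG oV V0.
(* Below [W], the two sons have disjoint closures, both inside [W `&` G n]. *)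
have step (WN : set T * nat) : exists S : bool -> set T,
    open WN.1 -> WN.1 !=set0 ->
    [/\ forall i, open (S i), forall i, S i !=set0,
        forall i, closure (S i) `<=` WN.1 `&` G WN.2 &
        closure (S false) `&` closure (S true) = set0].
  case: WN => W n /=.
  have [oW|] := pselect (open W); last by exists (fun=> set0).
  have [W0|] := pselect (W !=set0); last by exists (fun=> set0).
  have [x WGx] := dG n W W0 oW.
  have oWG : open (W `&` G n) by exact: openI.
  have [y [WGy xy]] : exists y, (W `&` G n) y /\ x <> y.
    apply: contrapT => nex; apply: (niso x).
    suff <- : W `&` G n = [set x] by [].
    apply/seteqP; split=> [y WGy|_ ->//] /=.
    by apply: contrapT => yx; apply: nex; exists y; split=> // /esym.
  have [U0 [U1 [oU0 oU1 U0x U1y U01]]] := hausdorff_disjoint_open hT xy.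
  have nx : nbhs x (W `&` G n `&` U0).
    by apply: open_nbhs_nbhs; split=> //; exact: openI.
  have ny : nbhs y (W `&` G n `&` U1).
    by apply: open_nbhs_nbhs; split=> //; exact: openI.
  have [S0 [oS0 S0x cS0]] := compact_shrink hT cT nx.
  have [S1 [oS1 S1y cS1]] := compact_shrink hT cT ny.
  exists (fun i => if i then S1 else S0) => _ _; split.
  - by case.
  - by case; [exists y|exists x].
  - by case=> z; [move=> /cS1 []|move=> /cS0 []].
  - rewrite -subset0 -U01 => z [/cS0 [_ ?] /cS1 [_ ?]]; split=> //.
have [S SP] := choice step.
pose U (a : nat -> bool) := fix U n :=
  if n is m.+1 then S (U m, m) (a m) else V.
have UP a n : open (U a n) /\ U a n !=set0.
  elim: n => [//|n [oU U0]] /=.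
  by have [? ? _ _] := SP (U a n, n) oU U0.
have USub a n : closure (U a n.+1) `<=` U a n `&` G n.
  by have [oU U0] := UP a n; have [_ _ + _] := SP (U a n, n) oU U0; apply.
have Udec a n k : U a (n + k) `<=` U a n.
  elim: k => [|k IH]; first by rewrite addn0.
  by rewrite addnS => x /subset_closure/USub [/IH].
(* A cluster point of points chosen along the branch [a]. *)
have pick a : exists x, forall n, closure (U a n) x.
  have [p pP] := choice (fun n => (UP a n).2).
  have [x [_ clx]] := cT (p @ \oo) _ filterT.
  exists x => n; apply: (closureS (A := p @` [set k | (n <= k)%N])).
    by move=> _ [k /= nk <-]; rewrite -(subnKC nk) in pP *; apply: Udec (pP _).
  move=> B Bx; apply: clx Bx; rewrite nbhs_simpl /=.
  by exists n => // k nk; exists k.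
have [F FP] := choice pick.
exists F; split; last first.
  by move=> a; split=> [|n]; [have [] := USub a 0 _ (FP a 1)
    | have [] := USub a n _ (FP a n.+1)].
move=> a a' Faa'.
suff agree : forall n, U a n = U a' n /\ a n = a' n.
  by apply/funext => n; have [] := agree n.
have next n : U a n = U a' n -> a n = a' n.
  move=> Un; have [oU U0] := UP a n.
  have [_ _ _ dis] := SP (U a n, n) oU U0.
  have Fa := FP a n.+1; have := FP a' n.+1; rewrite -Faa' => Fa'.
  rewrite /= -Un in Fa Fa'.
  case: (a n) (a' n) Fa Fa' => -[] // Fa Fa'; exfalso.
    by suff : set0 (F a) by []; rewrite -dis; split.
  by suff : set0 (F a) by []; rewrite -dis; split.
elim=> [|n [IHU IHa]]; first by split=> //; exact: next.
have UE : U a n.+1 = U a' n.+1 by rewrite /= IHU IHa.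
by split=> //; exact: next.
Qed.

Lemma no_injection_cantor_nat (h : (nat -> bool) -> nat) : ~ injective h.
Proof.
move=> hinj.
pose d n := `[< exists a, h a = n /\ ~~ a n >].
have [dd|dd] := boolP (d (h d)).
  by have /asboolP [a [/hinj -> ]] := dd; rewrite dd.
by have /asboolP := dd; apply; exists d.
Qed.

(** * Components and quasicomponents *)

(** The clopen sets containing [x] are closed under intersection, so by
compactness one of them already avoids the complement of [W]. *)
Lemma quasicomponent_clopen_nbhs (T : topologicalType) (x : T) (W : set T) :
  compact [set: T] -> open W ->
  (forall y, (forall D, clopen D -> D x -> D y) -> W y) ->
  exists D, [/\ clopen D, D x & D `<=` W].
Proof.
move=> cT oW QW.
have /compact_near_coveringP cK : compact (~` W).
  by apply: subclosed_compact cT _ => //; exact: open_closedC.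
pose F := filter_from [set D : set T | clopen D /\ D x]
  (fun D => [set E | E `<=` D]).
have FF : Filter F.
  apply: filter_from_filter; first by exists setT; split=> //; exact: clopenT.
  move=> D E [cD Dx] [cE Ex]; exists (D `&` E).
    by split=> //; exact: clopenI.
  by move=> H HDE; split=> y /HDE [].
have [y Wy|D [cD Dx] /(_ D (fun _ => id)) /= DW] :=
    cK _ F (fun E y => ~ E y) FF; last first.
  by exists D; split=> // y Dy; apply: contrapT => /DW; apply.
have /existsNP [D /not_implyP [cD /not_implyP [Dx Dy]]] :
  ~ forall D, clopen D -> D x -> D y by move=> /QW.
exists (~` D, [set E | E `<=` D]) => /=.
  split; last by exists D.
  by apply: open_nbhs_nbhs; split=> //; apply: closed_openC; case: cD.
by move=> [z E] /= [nDz ED] /ED.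
Qed.

(** If the quasicomponent were the union of two disjoint closed sets [A] and
[B], normality would give an open [U] around [A] whose closure misses [B]; a
clopen neighbourhood of the quasicomponent inside [U `|` ~` closure U] is cut
by [U] into clopen pieces, which puts the whole quasicomponent in [U]. *)
Lemma quasicomponent_connected (T : topologicalType) (x : T) :
  hausdorff_space T -> compact [set: T] ->
  connected [set y | forall D : set T, clopen D -> D x -> D y].
Proof.
move=> hT cT; set Q := [set y | _].
have cQ : closed Q.
  have -> : Q = \bigcap_(D in [set D | clopen D /\ D x]) D.
    by apply/seteqP; split=> y Qy D => [[]|? ?]; [exact: Qy|exact: Qy].
  by apply: closed_bigI => D [[]].
have Qx : Q x by [].
have key (A B : set T) : closed A -> closed B -> A `&` B = set0 ->
    Q `<=` A `|` B -> A x -> Q `<=` A.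
  move=> cA cB AB QAB Ax.
  have AnB : set_nbhs A (~` B).
    apply/set_nbhsP; exists (~` B); split=> //; first exact: closed_openC.
    by apply/disjoints_subset.
  have [U0 AU0 UB] := compact_normal hT cT cA AnB.
  have /set_nbhsP [U [oU AU UU0]] := AU0.
  have {}UB : closure U `<=` ~` B by apply: subset_trans UB; exact: closureS.
  have oW : open (U `|` ~` closure U).
    by apply: openU => //; apply/closed_openC/closed_closure.
  have [y Qy|D [[oD cD] Dx DW]] := quasicomponent_clopen_nbhs (x := x) cT oW.
    have [/AU|By] := QAB y Qy; first by left.
    by right=> /UB.
  have clDU : clopen (D `&` U).
    split; first exact: openI.
    have -> : D `&` U = D `&` closure U.
      apply/seteqP; split=> y [Dy Uy]; split=> //; first exact: subset_closure.
      by have [] := DW y Dy.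
    by apply: closedI => //; exact: closed_closure.
  move=> y Qy; have [//|By] := QAB y Qy.
  have [_ /subset_closure /UB] // := Qy _ clDU (conj Dx (AU _ Ax)).
move=> B [y By] [C oC BC] [D cD BD].
have cB : closed B by rewrite BD; exact: closedI.
have cB' : closed (Q `&` ~` C) by apply: closedI => //; exact: open_closedC.
have dis : B `&` (Q `&` ~` C) = set0.
  by rewrite -subset0 BC => z [[_ ?] [_]].
have QU : Q `<=` B `|` (Q `&` ~` C).
  by move=> z Qz; have [Cz|Cz] := pselect (C z); [left; rewrite BC|right].
apply/seteqP; split; first by rewrite BC => ? [].
have [Bx|Bx] := QU x Qx; first exact: (key B _ cB cB' dis QU Bx).
rewrite setIC in dis; rewrite setUC in QU.
have QC := key _ _ cB' cB dis QU Bx.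
by move: By; rewrite BC => -[/QC [_]].
Qed.

Lemma C1_clopen_nbhs (T : topologicalType) (x : T) (U : set T) :
  hausdorff_space T -> compact [set: T] -> C1 T x -> nbhs x U ->
  exists D, [/\ clopen D, D x & D `<=` U].
Proof.
move=> hT cT C1x Ux.
have [|D [cD Dx DU]] :=
    quasicomponent_clopen_nbhs (x := x) cT (open_interior U) _; last first.
  by exists D; split=> // y /DU /interior_subset.
move=> y Qy; suff -> : y = x by exact: nbhs_singleton (nbhs_interior Ux).
suff : connected_component [set: T] x y by rewrite C1x.
exists [set y | forall D : set T, clopen D -> D x -> D y] => //.
by split=> //; exact: quasicomponent_connected.
Qed.

(** * Compact metrizable spaces *)

Definition countable_base (T : topologicalType) (b : nat -> set T) :=
  (forall n, open (b n)) /\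
  forall x U, nbhs x U -> exists n, b n x /\ b n `<=` U.

Lemma homeomorphic_compact (X Y : topologicalType) :
  homeomorphic X Y -> compact [set: X] -> compact [set: Y].
Proof.
move=> [f [g [cf cg fK gK]]] cX.
have -> : [set: Y] = f @` [set: X].
  by apply/seteqP; split=> // y _; exists (g y).
by apply: continuous_compact => //; exact: continuous_subspaceT.
Qed.

Lemma metrizable_hausdorff (R : realType) (X : topologicalType) :
  metrizable R X -> hausdorff_space X.
Proof.
move=> [M [f [g [cf cg fK gK]]]] p q pq.
apply: (can_inj fK); apply: metric_hausdorff => A B Ap Bq.
have [x [Ax Bx]] := pq _ _ (cf p A Ap) (cf q B Bq).
by exists (f x).
Qed.

Lemma compact_metric_countable_base (R : realType) (M : metricType R) :
  compact [set: M] -> exists b : nat -> set M, countable_base b.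
Proof.
move=> cM.
(* A pointed structure on [M] requires a point, so the empty space is treated
   apart. *)
have [[p]|nM] := pselect (inhabited M); last first.
  by exists (fun=> set0); split=> [n|x]; [exact: open0|case: nM].
pose P := HB.pack_for (pseudoPMetricType R) (M : Type) (isPointed.Build M p)
  (PseudoMetric.class M).
have [B cB [oB bB]] := @compact_second_countable R P cM.
have /pfcard_geP[B0|[s]] := cB.
  by have [U []] := bB p setT filterT; rewrite B0.
exists s; split=> [n|x U /bB [V [BV Vx] VU]].
  by apply: oB; apply: funS.
have [n _ sn] := 'surj_s BV.
by exists n; rewrite sn.
Qed.

Lemma metrizable_countable_base (R : realType) (X : topologicalType) :
  compact [set: X] -> metrizable R X ->
  exists b : nat -> set X, countable_base b.
Proof.
move=> cX [M XM].
have [b [ob bb]] := compact_metric_countable_base (homeomorphic_compact XM cX).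
have [f [g [cf cg fK gK]]] := XM.
exists (fun n => f @^-1` b n); split=> [n|x U Ux].
  by apply: open_comp => // y _; exact: cf.
have [|n [bx bU]] := bb (f x) (g @^-1` U).
  by apply: cg; rewrite fK.
by exists n; split=> // y /bU /=; rewrite fK.
Qed.

(** * The set of one-point components *)

(** Points at which some clopen set decides between [B] and the complement of
[closure A]. The condition is vacuous when [closure A] is not inside [B], so
that countably many pairs of basic open sets can be enumerated freely. *)
Definition clopen_separated (T : topologicalType) (A B : set T) : set T :=
  [set x | closure A `<=` B ->
    exists D, [/\ clopen D, D x & D `<=` B \/ D `&` closure A = set0]].

Lemma open_clopen_separated (T : topologicalType) (A B : set T) :
  open (clopen_separated A B).
Proof.
rewrite openE => x sx.
have [AB|AB] := pselect (closure A `<=` B); last first.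
  by apply: filterS filterT => y _ /AB.
have [D [cD Dx DP]] := sx AB.
have oD : nbhs x D by apply: open_nbhs_nbhs; split=> //; case: cD.
by apply: filterS oD => y Dy _; exists D.
Qed.

Lemma dense_clopen_separated (T : topologicalType) (A B : set T) :
  (forall V : set T, open V -> V !=set0 ->
    exists D, [/\ clopen D, D !=set0 & D `<=` V]) ->
  open B -> dense (clopen_separated A B).
Proof.
move=> small oB V [x Vx] oV.
have [AB|AB] := pselect (closure A `<=` B); last by exists x; split=> // /AB.
have [Bx|Bx] := pselect (B x).
  have [||D [cD [y Dy] DVB]] := small (V `&` B); first exact: openI.
    by exists x.
  exists y; split; first by have [] := DVB y Dy.
  by exists D; split=> //; left=> z /DVB [].
have [||D [cD [y Dy] DVB]] := small (V `&` ~` closure A).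
- by apply: openI => //; apply/closed_openC/closed_closure.
- by exists x; split=> // /AB.
exists y; split; first by have [] := DVB y Dy.
by exists D; split=> //; right; rewrite -subset0 => z [/DVB [_]].
Qed.

Definition pair_of_nat (n : nat) : nat * nat := odflt (0, 0) (unpickle n).

(** A point [x] of all the [clopen_separated] sets is separated from any [y <> x]
by taking [B] to be a basic neighbourhood of [x] that avoids [y] and [A] a
smaller one: a clopen set around [x] meets [A], hence lies in [B]. *)
Lemma C1_bigcap (T : topologicalType) (b : nat -> set T) :
  hausdorff_space T -> compact [set: T] -> countable_base b ->
  C1 T = \bigcap_n clopen_separated (b (pair_of_nat n).1) (b (pair_of_nat n).2).
Proof.
move=> hT cT [ob bb]; apply/seteqP; split=> x.
  move=> C1x n _; case: (pair_of_nat n) => i j /= Aij.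
  have [bx|bx] := pselect (b j x).
    have [D [cD Dx DU]] :=
      C1_clopen_nbhs hT cT C1x (open_nbhs_nbhs (conj (ob j) bx)).
    by exists D; split=> //; left.
  have nx : nbhs x (~` closure (b i)).
    apply: open_nbhs_nbhs; split; first exact/closed_openC/closed_closure.
    by move=> /Aij.
  have [D [cD Dx DU]] := C1_clopen_nbhs hT cT C1x nx.
  by exists D; split=> //; right; apply/disjoints_subset.
move=> sx; apply/seteqP; split=> [y Cy|_ ->]; last exact: connected_component_refl.
apply: contrapT => /= yx.
have [j [bjx bj]] := bb x (~` [set y])
  (open_nbhs_nbhs (conj (hausdorff_openC1 y hT) (nesym yx))).
have [V [oV Vx VB]] :=
  compact_shrink hT cT (open_nbhs_nbhs (conj (ob j) bjx)).
have [i [bix bi]] := bb x V (open_nbhs_nbhs (conj oV Vx)).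
have := sx (pickle (i, j)) I; rewrite /pair_of_nat pickleK /= => sij.
have [|D [[oD cD] Dx [Dj|Di]]] := sij.
- by apply: subset_trans VB; exact: closureS.
- have [C [Cx _ conC] Cy'] := Cy.
  have CD : C `&` D = C.
    by apply: conC; [exists x|exists D|exists D].
  have [_ /Dj /bj nyy] : (C `&` D) y by rewrite CD.
  exact: nyy.
- by suff : set0 x by []; rewrite -Di; split=> //; exact: subset_closure.
Qed.

Lemma C1_dense_Gdelta_continuum (T : topologicalType) (b : nat -> set T) :
  hausdorff_space T -> compact [set: T] -> countable_base b ->
  (forall x : T, ~ open [set x]) -> [set: T] !=set0 ->
  (forall V : set T, open V -> V !=set0 ->
    exists D, [/\ clopen D, D !=set0 & D `<=` V]) ->
  [/\ dense (C1 T), Gdelta (C1 T) & C1 T #= [set: set nat]].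
Proof.
move=> hT cT bT niso T0 small; have [ob bb] := bT.
set G := fun n => clopen_separated (b (pair_of_nat n).1) (b (pair_of_nat n).2).
have C1E : C1 T = \bigcap_n G n by exact: C1_bigcap.
have oG n : open (G n) by exact: open_clopen_separated.
have dG n : dense (G n) by exact: dense_clopen_separated.
split.
- move=> V V0 oV.
  have [F [_ FP]] := cantor_scheme hT cT niso oG dG oV V0.
  have [VF GF] := FP (fun=> true).
  by exists (F (fun=> true)); split=> //; rewrite C1E => n _.
- by exists G.
apply: Cantor_Bernstein.
  pose code (x : T) : set nat := [set n | b n x].
  have codeI : {in C1 T &, injective code}.
    move=> x y _ _ xy; apply: contrapT => nxy.
    have [n [bx bn]] := bb x (~` [set y])
      (open_nbhs_nbhs (conj (hausdorff_openC1 y hT) nxy)).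
    by have : code y n; [rewrite -xy|move=> /bn /=; exact].
  by rewrite -(card_le_eql (inj_card_eq codeI)); exact: card_leT.
have [F [Finj FP]] := cantor_scheme hT cT niso oG dG openT T0.
pose F' (A : set nat) := F (fun n => n \in A).
have F'I : {in [set: set nat] &, injective F'}.
  move=> A B _ _ /Finj AB; apply/funext => n; apply/propext.
  have ABn : (n \in A) = (n \in B) by have /(congr1 (@^~ n)) := AB.
  by split=> /mem_set; [rewrite ABn|rewrite -ABn] => /set_mem.
rewrite -(card_le_eql (inj_card_eq F'I)); apply: subset_card_le.
by move=> _ [A _ <-]; rewrite C1E => n _; have [_] := FP (fun n => n \in A).
Qed.

(** * Splitting of punctured neighbourhoods *)

(** A colouring encodes a partition of a punctured neighbourhood of [x] into open
sets. Only the first [n] colours are required to accumulate at [x]; there may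
be others, so that a new colour can be added without renaming. *)
Definition splits (T : topologicalType) (n : nat) (x : T) : Prop :=
  exists c : T -> nat,
    (\forall w \near x, w <> x -> \forall v \near w, c v = c w) /\
    forall i, (i < n)%N -> closure [set w | w <> x /\ c w = i] x.

Lemma splits0 (T : topologicalType) (x : T) : splits 0 x.
Proof.
exists (fun=> 0); split=> //.
by apply: filterS filterT => w _ _; apply: filterS filterT.
Qed.

Lemma splits_not_isolated (T : topologicalType) (n : nat) (x : T) :
  splits n.+1 x -> ~ open [set x].
Proof.
move=> [c [_ cl]] ox.
have [w [[wx _] /= wE]] := cl 0 (ltn0Sn n) _ (open_nbhs_nbhs (conj ox (erefl x))).
exact: wx.
Qed.

(** * Points that split into three parts *)

(** The set [S] is an open piece of [A] inside [W] that contains all of [A] near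
[x] and has no boundary point but [x]. When [x] is a closed point in the
closure of [A], the set [S `|` [set x]] is closed, and it is relatively open in
[A `|` [set x]]. *)
Definition sprout (T : topologicalType) (A : set T) (x : T) (W : set T) : Prop :=
  exists S : set T, [/\ open S, closure S `<=` S `|` [set x], S `<=` A `&` W &
    exists2 O, open_nbhs x O & A `&` O `<=` S].

(** Without nonempty clopen sets in [V], a sprout is contained in every other
sprout, because the part of it left over by the other one would be clopen. A
neighbourhood of [x] that misses one point of a given sprout therefore contains
no sprout. *)
Lemma small_nbhs_no_sprout (T : topologicalType) (V A : set T) (x : T) :
  hausdorff_space T ->
  (forall D : set T, clopen D -> D `<=` V -> D = set0) ->
  A `<=` V -> ~ A x -> closure A x ->
  exists2 N, nbhs x N & ~ sprout A x N.
Proof.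
move=> hT noclopen AV nAx clAx.
have [[S [oS cS SA [O xO AOS]]]|ns] := pselect (sprout A x setT); last first.
  by exists setT => //; exact: filterT.
have [w [Aw Ow]] := clAx O (open_nbhs_nbhs xO).
have Sw : S w by exact: AOS.
exists (~` [set w]).
  apply: open_nbhs_nbhs; split; first exact: hausdorff_openC1.
  by move=> /= xw; apply: nAx; rewrite xw.
move=> [S' [oS' cS' SA' [O' [oO' O'x] AOS']]].
have Sx : ~ S x by move=> /SA [].
have DE : S `&` ~` closure S' = closure S `&` ~` (S' `|` O').
  apply/seteqP; split=> z.
    move=> [Sz S'z]; split; first exact: subset_closure.
    case=> [/subset_closure //|O'z]; apply/S'z/subset_closure/AOS'; split=> //.
    by have [] := SA z Sz.
  move=> [/cS Sxz /not_orP [S'z O'z]].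
  have zx : z <> x by move=> zx; apply: O'z; rewrite zx.
  by case: Sxz => // Sz; split=> // /cS' [].
have : (S `&` ~` closure S') w.
  split=> // /cS' [/SA' [_ ww]|wx]; first exact: ww.
  by apply: Sx; rewrite -wx.
rewrite (noclopen (S `&` ~` closure S')) //; last by move=> z [/SA [/AV]].
split; first by apply: openI => //; apply/closed_openC/closed_closure.
rewrite DE; apply: closedI; first exact: closed_closure.
by apply: open_closedC; exact: openU.
Qed.

Definition basic_union (T : topologicalType) (b : nat -> set T) (s : seq nat) :
  set T := \bigcup_(j in [set` s]) b j.

(** [p] records a basic neighbourhood [b p.1] of [x] and, for the first three
parts [A i] at [x], finite unions of basic open sets with the same trace as
[A i] on the boundary of [b p.1]. The unions stay inside [A i], so they can be
compared between two points that share [p]. *)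
Definition codes (T : topologicalType) (b : nat -> set T) (x : T)
    (p : nat * seq (seq nat)) : Prop :=
  exists A : nat -> set T,
    [/\ b p.1 x,
        (forall i, open (A i)) /\ (forall i j z, A i z -> A j z -> i = j),
        forall z, closure (b p.1) z -> z <> x -> exists i, A i z,
        forall i, (i < 3)%N -> ~ sprout (A i) x (b p.1) &
        forall i, (i < 3)%N ->
          A i `&` (closure (b p.1) `\` b p.1) `<=` basic_union b (nth [::] p.2 i)
          /\ basic_union b (nth [::] p.2 i) `<=` A i].

(** If [y] is in the part [A j] of [x] and [x] in the part [A' l] of [y], some
[i < 3] differs from both, and [A i `&` A' l `&` b p.1] is a sprout at [x]. Its
closure cannot reach the boundary of [b p.1], where the traces of [A i] and
[A' i] agree while [A' i] and [A' l] are disjoint; nor can it contain [y],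
which is in [A j]. *)
Lemma codes_inj (T : topologicalType) (b : nat -> set T) (x y : T)
    (p : nat * seq (seq nat)) :
  open (b p.1) -> codes b x p -> codes b y p -> x = y.
Proof.
move=> ob [A [bx [oA dA] coverA nA bdA]] [A' [b_y [oA' dA'] coverA' _ bdA']].
apply: contrapT => xy.
have [j Ajy] := coverA y (subset_closure b_y) (nesym xy).
have [l Alx] := coverA' x (subset_closure bx) xy.
have [i [i3 ij il]] : exists i, [/\ (i < 3)%N, i <> j & i <> l].
  by case: j l {Ajy Alx} => [|[|j]] [|[|l]];
    first [by exists 0 | by exists 1 | by exists 2].
apply: (nA i i3); exists (A i `&` A' l `&` b p.1); split.
- by apply: openI => //; exact: openI.
- move=> z clz; have [->|zx] := pselect (z = x); first by right.
  have clA : closure (A i) z by apply: closureS clz => ? [[]].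
  have clA' : closure (A' l) z by apply: closureS clz => ? [[]].
  have clb : closure (b p.1) z by apply: closureS clz => ? [].
  have Az : A i z.
    have [i' Aiz] := coverA z clb zx.
    have [v [Av Av']] := clA _ (open_nbhs_nbhs (conj (oA i') Aiz)).
    by rewrite (dA _ _ _ Av Av').
  have zy : z <> y by move=> zy; apply: ij; apply: dA Az _; rewrite zy.
  have Az' : A' l z.
    have [l' Alz] := coverA' z clb zy.
    have [v [Av Av']] := clA' _ (open_nbhs_nbhs (conj (oA' l') Alz)).
    by rewrite (dA' _ _ _ Av Av').
  have [bz|bz] := pselect (b p.1 z); first by left.
  have [/(_ z (conj Az (conj clb bz))) Oz _] := bdA i i3.
  by case: il; apply: dA' Az'; have [_] := bdA' i i3; apply.
- by move=> z [[Az _] bz].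
- exists (A' l `&` b p.1); first by split=> //; exact: openI.
  by move=> z [Az [Alz bz]].
Qed.

Lemma codes_exist (T : topologicalType) (b : nat -> set T) (V : set T) (x : T) :
  hausdorff_space T -> compact [set: T] -> countable_base b ->
  (forall D : set T, clopen D -> D `<=` V -> D = set0) ->
  open V -> V x -> splits 3 x -> exists p, codes b x p.
Proof.
move=> hT cT [ob bb] noclopen oV Vx [c [cx clx]].
pose good := V `&` [set w | w <> x -> \forall v \near w, c v = c w].
have ngood : nbhs x good by apply: filterI cx; exact: open_nbhs_nbhs.
pose M := interior good.
have oM : open M by exact: open_interior.
have Mx : M x by exact: nbhs_singleton (nbhs_interior ngood).
have MV : M `<=` good by exact: interior_subset.
pose A i := M `&` [set w | w <> x /\ c w = i].
have oA i : open (A i).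
  rewrite openE => w [Mw [wx cwi]].
  have [_ /(_ wx) cw] := MV w Mw.
  have nM : nbhs w M by exact: open_nbhs_nbhs.
  have nx : nbhs w (~` [set x]).
    by apply: open_nbhs_nbhs; split=> //; exact: hausdorff_openC1.
  apply: filterS (filterI nM (filterI nx cw)) => v [Mv [vx cvw]].
  by split=> //; split=> //; rewrite cvw.
have dA i j z : A i z -> A j z -> i = j by move=> [_ [_ <-]] [_ [_ <-]].
have nAx i : ~ A i x by move=> [_ []].
have clA i : (i < 3)%N -> closure (A i) x.
  move=> i3 U Ux.
  have [w [wci [Uw Mw]]] := clx i i3 _ (filterI Ux (open_nbhs_nbhs (conj oM Mx))).
  by exists w.
have AV i : A i `<=` V by move=> w [/MV []].
have pickN i : exists N, (i < 3)%N -> nbhs x N /\ ~ sprout (A i) x N.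
  have [i3|] := boolP (i < 3)%N; last by exists setT.
  have [N Nx nN] := small_nbhs_no_sprout hT noclopen (AV i) (nAx i)
    (clA i i3).
  by exists N.
have [N NP] := choice pickN.
have nN : nbhs x (M `&` (N 0 `&` (N 1 `&` N 2))).
  apply: filterI; first exact: open_nbhs_nbhs.
  have Nx i : (i < 3)%N -> nbhs x (N i) by move=> /NP [].
  exact: filterI (Nx 0 isT) (filterI (Nx 1 isT) (Nx 2 isT)).
have [W [oW Wx WN]] := compact_shrink hT cT nN.
have [k [bx bW]] := bb x W (open_nbhs_nbhs (conj oW Wx)).
have bN : closure (b k) `<=` M `&` (N 0 `&` (N 1 `&` N 2)).
  exact: subset_trans (closureS bW) WN.
have coverA z : closure (b k) z -> z <> x -> exists i, A i z.
  by move=> /bN [Mz _] zx; exists (c z).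
(* [A i] is closed in [closure (b k)] except at [x], which is not on the
   boundary; hence its trace on the boundary is compact. *)
have picks i : exists s,
    A i `&` (closure (b k) `\` b k) `<=` basic_union b s /\ basic_union b s `<=` A i.
  have cbd : compact (A i `&` (closure (b k) `\` b k)).
    apply: (subclosed_compact _ cT) => // z clz.
    have clb : (closure (b k) `\` b k) z.
      have -> : closure (b k) `\` b k = closure (closure (b k) `\` b k).
        apply/closure_id; apply: closedI; first exact: closed_closure.
        exact: open_closedC.
      by apply: closureS clz => ? [].
    split=> //.
    have [|j Ajz] := coverA z clb.1; first by move=> zx; apply: clb.2; rewrite zx.
    have [w [[Aiw _] Ajw]] := clz _ (open_nbhs_nbhs (conj (oA j) Ajz)).
    by rewrite (dA _ _ _ Aiw Ajw).
  have [|s [sD sA]] := compact_finite_cover (D := [set j | b j `<=` A i]) cbd ob.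
    move=> z [Az _].
    by have [j [bz bA]] := bb z (A i) (open_nbhs_nbhs (conj (oA i) Az)); exists j.
  by exists s; split=> // z [j /sD]; apply.
have [s sP] := choice picks.
exists (k, mkseq s 3), A; split=> //= i i3.
  move=> [S [oS cS SA OS]]; have [_ []] := NP i i3.
  exists S; split=> // z /SA [Az /subset_closure/bN [_ [N0 [N1 N2]]]].
  by split=> //; case: i i3 {SA OS Az} => [|[|[|]]].
by rewrite (nth_mkseq _ _ i3).
Qed.

(** Without clopen sets inside [V], codes would inject the uncountable set [V]
into a countable type. *)
Lemma trisected_open_clopen (T : topologicalType) (b : nat -> set T) (V : set T) :
  hausdorff_space T -> compact [set: T] -> countable_base b ->
  (forall x : T, splits 3 x) -> open V -> V !=set0 ->
  exists D, [/\ clopen D, D !=set0 & D `<=` V].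
Proof.
move=> hT cT bT sT oV V0; apply: contrapT => noD.
have noclopen D : clopen D -> D `<=` V -> D = set0.
  move=> cD DV; apply/eqP; apply: contrapT => /negP/set0P D0.
  by apply: noD; exists D.
have pickp x : exists p, V x -> codes b x p.
  have [Vx|] := pselect (V x); last by exists (0, [::]).
  by have [p] := codes_exist hT cT bT noclopen oV Vx (sT x); exists p.
have [code codeP] := choice pickp.
have niso (x : T) : ~ open [set x] by exact: (splits_not_isolated (sT x)).
have dT (n : nat) : dense [set: T] by move=> O [x Ox] _; exists x.
have [F [Finj FV]] := cantor_scheme hT cT niso (fun=> openT) dT oV V0.
apply: (@no_injection_cantor_nat (fun a => pickle (code (F a)))) => a a'.
move=> /(pcan_inj pickleK) caa'; apply: Finj.
apply: (codes_inj (b := b) (p := code (F a))); first by case: bT.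
  by apply: codeP; have [] := FV a.
by rewrite caa'; apply: codeP; have [] := FV a'.
Qed.

(** * Homeomorphisms away from a point *)

(** A homeomorphism between the complements of [x] and [z], extended by
[x |-> z]. Total maps avoid working in subtypes. *)
Definition homeo_off (X Z : topologicalType) (x : X) (z : Z)
    (f : X -> Z) (g : Z -> X) : Prop :=
  [/\ cancel f g, cancel g f, f x = z,
      forall y, y <> x -> {for y, continuous f} &
      forall w, w <> z -> {for w, continuous g}].

Lemma homeo_off_sym (X Z : topologicalType) (x : X) (z : Z) f g :
  homeo_off x z f g -> homeo_off z x g f.
Proof. by move=> [fK gK fx cf cg]; split=> //; rewrite -fx fK. Qed.

Lemma compact_image_off (X Z : topologicalType) (x : X) (f : X -> Z) (K : set X) :
  (forall y, y <> x -> {for y, continuous f}) ->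
  compact K -> ~ K x -> compact (f @` K).
Proof.
move=> cf cK nKx; apply: continuous_compact => //.
apply: continuous_in_subspaceT => y /set_mem Ky; apply: cf.
by move=> yx; apply: nKx; rewrite -yx.
Qed.

(** At [x], the complement of an open neighbourhood of [z] is compact, so its image
under [g] is compact, hence closed, and misses [x]. *)
Lemma homeo_off_continuous (X Z : topologicalType) (x : X) (z : Z) f g :
  hausdorff_space X -> compact [set: Z] -> homeo_off x z f g -> continuous f.
Proof.
move=> hX cZ [fK gK fx cf cg] y.
have [->{y}|/cf //] := pselect (y = x).
move=> U; rewrite nbhsE fx => -[O [oO Oz] OU].
have cO : compact (g @` (~` O)).
  apply: compact_image_off cg _ _ => //.
  by apply: subclosed_compact cZ _ => //; exact: open_closedC.
have nx : nbhs x (~` (g @` (~` O))).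
  apply: open_nbhs_nbhs; split; first by apply: closed_openC; exact: compact_closed.
  by move=> [w nOw gw]; apply: nOw; rewrite -(gK w) gw fx.
apply: filterS nx => v nv; apply: OU; apply: contrapT => nOv.
by apply: nv; exists (f v).
Qed.

Lemma homeo_off_compact (X Z : topologicalType) (x : X) (z : Z) f g :
  hausdorff_space X -> hausdorff_space Z -> compact [set: X] -> compact [set: Z] ->
  homeo_off x z f g -> homeomorphic Z X.
Proof.
move=> hX hZ cX cZ fg; have [fK gK _ _ _] := fg.
exists g, f; split=> //.
  exact: homeo_off_continuous hZ cX (homeo_off_sym fg).
exact: homeo_off_continuous hX cZ fg.
Qed.

Lemma splits_homeo_off (X Z : topologicalType) (x y : X) (z : Z) f g (n : nat) :
  hausdorff_space X -> hausdorff_space Z ->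
  homeo_off x z f g -> y <> x -> splits n y -> splits n (f y).
Proof.
move=> hX hZ [fK gK fx cf cg] yx [c [cy cly]].
have fyz : f y <> z by rewrite -fx => /(can_inj fK).
exists (c \o g); split.
  have gy : nbhs (f y) (g @^-1` [set w | w <> y -> \forall v \near w, c v = c w]).
    by apply: cg => //; rewrite fK.
  have nz : nbhs (f y) (~` [set z]).
    by apply: open_nbhs_nbhs; split=> //; exact: hausdorff_openC1.
  apply: filterS (filterI gy nz) => w [gw wz] wfy.
  have /gw cw : g w <> y by move=> gwy; apply: wfy; rewrite -gwy gK.
  exact: cg cw.
move=> i iN U Ufy.
have nx : nbhs y (~` [set x]).
  by apply: open_nbhs_nbhs; split=> //; exact: hausdorff_openC1.
have [v [[vy cv] Uv]] := cly i iN _ (cf y yx U Ufy).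
exists (f v); split=> //; split=> [/(can_inj fK)//|].
by rewrite /= fK.
Qed.

Lemma locally_compact_off (X Z : topologicalType) (x : X) (z w : Z) f g (W : set Z) :
  hausdorff_space X -> compact [set: X] -> homeo_off x z f g ->
  w <> z -> nbhs w W -> exists K, [/\ compact K, nbhs w K & K `<=` W].
Proof.
move=> hX cX [fK gK fx cf cg] wz Ww.
have gwx : g w <> x by move=> gwx; apply: wz; rewrite -fx -gwx gK.
have nW : nbhs (g w) (f @^-1` W) by apply: cf; rewrite ?gK.
have nx : nbhs (g w) (~` [set x]).
  by apply: open_nbhs_nbhs; split=> //; exact: hausdorff_openC1.
have [L [oL Lw LW]] := compact_shrink hX cX (filterI nW nx).
exists (f @` closure L); split.
- apply: compact_image_off cf _ _; last by move=> /LW [_ xx]; exact: xx.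
  by apply: subclosed_compact cX _ => //; exact: closed_closure.
- have nL : nbhs w (g @^-1` L) by apply: cg => //; exact: open_nbhs_nbhs.
  by apply: filterS nL => v Lv; exists (g v) => //; exact: subset_closure.
- by move=> _ [v /LW [] ? _ <-].
Qed.

(** The extra part at [x] is the image of the complement of a compact
neighbourhood [K] of [z]: it accumulates at [x], since otherwise [Z] would be
the union of [K] and another compact set. The boundary of [K] is compact, so
its image stays away from [x]. *)
Lemma splits_succ (X Z : topologicalType) (x : X) (z : Z) f g (n : nat) :
  hausdorff_space X -> hausdorff_space Z -> compact [set: X] ->
  ~ compact [set: Z] ->
  (forall W, nbhs z W -> exists K, [/\ compact K, nbhs z K & K `<=` W]) ->
  homeo_off x z f g -> splits n z -> splits n.+1 x.
Proof.
move=> hX hZ cX ncZ lcZ fg [c [cz clz]].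
have cg : continuous g.
  exact: homeo_off_continuous hZ cX (homeo_off_sym fg).
have [fK gK fx cf _] := fg.
have gz : g z = x by rewrite -fx fK.
have [K [cK Kz KW]] := lcZ _ cz.
have clK : closed K by exact: compact_closed.
pose c' v := if `[< interior K (f v) >] then c (f v) else n.
exists c'; split.
  have cbd : compact (g @` (K `\` interior K)).
    apply: continuous_compact; first exact: continuous_subspaceT.
    apply: compact_closedI => //; apply: open_closedC; exact: open_interior.
  have nx : nbhs x (~` (g @` (K `\` interior K))).
    apply: open_nbhs_nbhs; split; first by apply: closed_openC; exact: compact_closed.
    by move=> [w [_ nKw] gw]; apply: nKw; rewrite -(gK w) gw fx.
  apply: filterS nx => v nv vx.
  have fvz : f v <> z by rewrite -fx => /(can_inj fK).
  have [Kv|Kv] := pselect (interior K (f v)).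
    have nK : nbhs (f v) (interior K) by exact: nbhs_interior.
    have /(_ fvz) cv := KW (f v) (interior_subset Kv).
    have nv' : nbhs v (f @^-1` (interior K `&` [set w | c w = c (f v)])).
      by apply: cf => //; exact: filterI.
    apply: filterS nv' => u [Ku cu].
    by rewrite /c' !asboolT.
  have nKv : (~` K) (f v) by move=> Kfv; apply: nv; exists (f v).
  have nK : nbhs (f v) (~` K).
    by apply: open_nbhs_nbhs; split=> //; exact: closed_openC.
  have nv' : nbhs v (f @^-1` (~` K)) by exact: cf.
  apply: filterS nv' => u nKu.
  by rewrite /c' !asboolF // => /interior_subset.
move=> i; rewrite ltnS leq_eqVlt => /orP[/eqP -> {i}|iN] U Ux; last first.
  have nU : nbhs z (g @^-1` U) by apply: cg; rewrite gz.
  have [w [[wz cw] [Uw Kw]]] := clz i iN _ (filterI nU (nbhs_interior Kz)).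
  exists (g w); split=> //; split; first by rewrite -gz => /(can_inj gK).
  by rewrite /c' gK asboolT.
apply: contrapT => nU; apply: ncZ.
have cU : compact (f @` (~` interior U)).
  apply: compact_image_off cf _ _; last first.
    by apply; exact: nbhs_singleton (nbhs_interior Ux).
  by apply: subclosed_compact cX _ => //; apply: open_closedC; exact: open_interior.
have -> : [set: Z] = K `|` f @` (~` interior U); last exact: compactU.
apply/seteqP; split=> // w _.
have [Kw|nKw] := pselect (K w); [by left|right].
exists (g w) => // /interior_subset Uw; apply: nU; exists (g w); split=> //; split.
  rewrite /= -gz => /(can_inj gK) wz; apply: nKw.
  by rewrite wz; exact: nbhs_singleton.
by rewrite /c' gK asboolF // => /interior_subset.
Qed.

(** * From decks to maps *)

(** Continuity of the restriction of [f] to the complement of [x]. It differs from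
continuity of [f] at the points [y <> x] as long as [x] is not known to be a
closed point. *)
Definition relatively_continuous_off (X Z : topologicalType) (x : X) (f : X -> Z) :=
  forall y, y <> x -> forall U, nbhs (f y) U -> nbhs y [set v | v <> x -> U (f v)].

Definition extend_card (X Z : topologicalType) (x : X) (z : Z)
    (F : card_at x -> card_at z) (y : X) : Z :=
  if pselect ((~` [set x]) y) is left ne
  then set_val (F (exist _ y (mem_set ne))) else z.

Lemma extend_card_val (X Z : topologicalType) (x : X) (z : Z)
    (F : card_at x -> card_at z) (u : card_at x) :
  extend_card F (set_val u) = set_val (F u).
Proof.
rewrite /extend_card; case: pselect => [ne|]; last by have := set_valP u.
by congr (set_val (F _)); exact: val_inj.
Qed.

Lemma extend_card_point (X Z : topologicalType) (x : X) (z : Z)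
    (F : card_at x -> card_at z) : extend_card F x = z.
Proof. by rewrite /extend_card; case: pselect => // ne; exfalso; exact: ne. Qed.

Lemma card_at_val (X : topologicalType) (x y : X) :
  y <> x -> exists u : card_at x, set_val u = y.
Proof.
move=> yx; have ny : (~` [set x]) y by [].
by exists (exist _ y (mem_set ny)).
Qed.

Lemma extend_cardK (X Z : topologicalType) (x : X) (z : Z)
    (F : card_at x -> card_at z) (G : card_at z -> card_at x) :
  cancel F G -> cancel (extend_card F) (extend_card G).
Proof.
move=> FK y; have [->|/card_at_val [u <-]] := pselect (y = x).
  by rewrite !extend_card_point.
by rewrite !extend_card_val FK.
Qed.

Lemma extend_card_continuous (X Z : topologicalType) (x : X) (z : Z)
    (F : card_at x -> card_at z) :
  continuous F -> relatively_continuous_off x (extend_card F).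
Proof.
move=> cF y /card_at_val [u <-] U; rewrite extend_card_val => UF.
have : nbhs u (F @^-1` (set_val @^-1` U)).
  by apply: cF; exact: (@initial_continuous _ _ set_val).
rewrite nbhsE => -[B [[W oW WB] Bu] BU].
have Wu : W (set_val u) by move: Bu; rewrite -WB.
apply: filterS (open_nbhs_nbhs (conj oW Wu)) => v Wv /card_at_val [v' vE].
rewrite -vE extend_card_val; apply: BU.
by rewrite -WB /= vE.
Qed.

Lemma deck_eq_card (X Z : topologicalType) (x : X) :
  deck Z = deck X -> exists z : Z, homeomorphic (card_at x) (card_at z).
Proof.
move=> ZX; have : deck X (homeo_class (card_at x)) by exists x.
rewrite -ZX => -[z xz]; exists z.
suff : homeo_class (card_at z) (card_at z) by rewrite -xz.
by exists id, id; split=> // ?; exact: cvg_id.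
Qed.

Definition relative_homeo_off (X Z : topologicalType) (x : X) (z : Z)
    (f : X -> Z) (g : Z -> X) : Prop :=
  [/\ cancel f g, cancel g f, f x = z,
      relatively_continuous_off x f & relatively_continuous_off z g].

Lemma homeomorphic_cards (X Z : topologicalType) (x : X) (z : Z) :
  homeomorphic (card_at x) (card_at z) ->
  exists f g, relative_homeo_off x z f g.
Proof.
move=> [F [G [cF cG FK GK]]]; exists (extend_card F), (extend_card G).
split; try exact: extend_cardK; try exact: extend_card_continuous.
exact: extend_card_point.
Qed.

Lemma relative_homeo_off_hausdorff (X Z : topologicalType) (x : X) (z : Z) f g :
  hausdorff_space X -> hausdorff_space Z ->
  relative_homeo_off x z f g -> homeo_off x z f g.
Proof.
move=> hX hZ [fK gK fx cf cg].
have off (S S' : topologicalType) (s : S) (h : S -> S') : hausdorff_space S ->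
    relatively_continuous_off s h -> forall y, y <> s -> {for y, continuous h}.
  move=> hS ch y ys U /(ch y ys) nU.
  have ns : nbhs y (~` [set s]).
    by apply: open_nbhs_nbhs; split=> //; exact: hausdorff_openC1.
  by apply: filterS (filterI ns nU) => v [/= vs /(_ vs)].
by split=> //; exact: off.
Qed.

(** Two points [a] and [b] have neighbourhoods [U] and [V] that meet at most in a
third point [c], obtained from the card at [c]. The card at [b] provides a
neighbourhood of [a] that avoids [c], and intersecting [U] with it makes it
disjoint from [V]. *)
Lemma hausdorff_of_cards (Z : topologicalType) :
  (forall z : Z, exists (X : topologicalType) (x : X) f g,
    hausdorff_space X /\ relative_homeo_off x z f g) ->
  (forall a b : Z, a <> b -> exists c, c <> a /\ c <> b) ->
  hausdorff_space Z.
Proof.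
move=> cardZ third.
have sep (a b c : Z) : a <> b -> a <> c -> b <> c -> exists U V,
    [/\ open_nbhs a U, open_nbhs b V & U `&` V `<=` [set c]].
  move=> ab ac bc; have [X [x [f [g [hX [fK gK fx cf cg]]]]]] := cardZ c.
  have gab : g a <> g b by move=> /(can_inj gK).
  have [P [Q [oP oQ Pa Qb PQ]]] := hausdorff_disjoint_open hX gab.
  have nU := cg a ac P (open_nbhs_nbhs (conj oP Pa)).
  have nV := cg b bc Q (open_nbhs_nbhs (conj oQ Qb)).
  exists (interior [set v | v <> c -> P (g v)]),
    (interior [set v | v <> c -> Q (g v)]); split.
  - by split; [exact: open_interior|exact: nbhs_singleton (nbhs_interior nU)].
  - by split; [exact: open_interior|exact: nbhs_singleton (nbhs_interior nV)].
  move=> v [/interior_subset Pv /interior_subset Qv]; apply: contrapT => vc.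
  by suff : set0 (g v) by []; rewrite -PQ; split; [exact: Pv|exact: Qv].
rewrite open_hausdorff => a b /eqP ab.
have [c [ca cb]] := third a b ab.
have [U [V [[oU Ua] [oV Vb] UV]]] := sep a b c ab (nesym ca) (nesym cb).
have [U' [W [[oU' U'a] [oW Wc] U'W]]] := sep a c b (nesym ca) ab cb.
exists (U `&` U', V); first by split; exact: mem_set.
split=> //=; first exact: openI.
apply/eqP; rewrite -subset0 => v [[Uv U'v] Vv].
have vc : v = c by exact: UV.
by apply: cb; apply: (U'W c); split; rewrite -?vc // vc.
Qed.

Lemma third_point (X Z : topologicalType) (a b : Z) (f : X -> Z) (g : Z -> X) :
  cancel f g -> cancel g f -> ~ ([set: X] #= `I_2) -> a <> b ->
  exists c, c <> a /\ c <> b.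
Proof.
move=> fK gK X2 ab; apply: contrapT => nc; apply: X2.
have XE y : y = g a \/ y = g b.
  have [fa|fa] := pselect (f y = a); first by left; rewrite -fa fK.
  have [fb|fb] := pselect (f y = b); first by right; rewrite -fb fK.
  by case: nc; exists (f y).
apply/eq_cardSP; exists (g a) => //; apply/eq_cardSP; exists (g b).
  by split=> // /(can_inj gK) /esym.
rewrite II0 card_eq0; apply/eqP; rewrite -subset0 => y [[_ ya] yb].
by have [] := XE y.
Qed.

(** Splitting into [n] parts at all points goes from [X] to [Z], where every
point is seen in a card that keeps it, and comes back to [X] with one more
part. *)
Lemma splits_of_not_reconstructible (X : topologicalType) :
  hausdorff_space X -> compact [set: X] -> ~ ([set: X] #= `I_2) ->
  ~ reconstructible X -> [set: X] !=set0 /\ forall n (x : X), splits n x.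
Proof.
move=> hX cX X2 /existsNP [Z /not_implyP [ZX nZX]].
have toX (z : Z) : exists (x : X) f g, relative_homeo_off x z f g.
  have [x [F [G [cF cG FK GK]]]] := deck_eq_card z (esym ZX).
  by exists x; apply: homeomorphic_cards; exists G, F.
have hZ : hausdorff_space Z.
  apply: hausdorff_of_cards => [z|a b ab].
    by have [x [f [g fg]]] := toX z; exists X, x, f, g.
  by have [x [f [g [fK gK _ _ _]]]] := toX a; exact: third_point fK gK X2 ab.
have {}toX (z : Z) : exists (x : X) f g, homeo_off x z f g.
  have [x [f [g fg]]] := toX z.
  by exists x, f, g; exact: relative_homeo_off_hausdorff.
have toZ (x : X) : exists (z : Z) f g, homeo_off x z f g.
  have [z /homeomorphic_cards [f [g fg]]] := deck_eq_card x ZX.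
  by exists z, f, g; exact: relative_homeo_off_hausdorff.
have [x0 X0] : [set: X] !=set0.
  apply: contrapT => nX; apply: nZX.
  have noX (x : X) : False by apply: nX; exists x.
  have noZ (z : Z) : False by have [x _] := toX z; exact: noX x.
  by exists (fun z => False_rect _ (noZ z)), (fun x => False_rect _ (noX x));
    split=> [z|x|z|x]; [case: (noZ z)|case: (noX x)|case: (noZ z)|case: (noX x)].
have ncZ : ~ compact [set: Z].
  move=> cZ; have [z [f [g fg]]] := toZ x0.
  exact/nZX/(homeo_off_compact hX hZ cX cZ fg).
have other (z : Z) : exists z', z' <> z.
  apply: contrapT => nz; apply: ncZ.
  have -> : [set: Z] = [set z]; last exact: compact_set1.
  apply/seteqP; split=> // w _ /=; apply: contrapT => wz.
  by apply: nz; exists w.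
split; first by exists x0.
elim=> [x|n IHn x]; first exact: splits0.
have [z [f [g fg]]] := toZ x.
have [z' z'z] := other z.
have [x' [f' [g' fg']]] := toX z'.
have [f'K g'K f'x' _ _] := fg'.
apply: splits_succ fg _ => // [W Wz|].
  exact: locally_compact_off fg' (nesym z'z) Wz.
rewrite -(g'K z); apply: splits_homeo_off fg' _ (IHn _) => // g'zx'.
by apply: z'z; rewrite -f'x' -g'zx' g'K.
Qed.

(** * Reconstruction *)

Theorem theorem2p8 (R : realType) (X : topologicalType)
    (X_compact : compact [set: X])
    (X_metrizable : metrizable R X)
    (X_not_two_points : ~ ([set: X] #= `I_2))
    (X_C1 : ~ [/\ dense (C1 X), Gdelta (C1 X) & C1 X #= [set: set nat]]) :
  reconstructible X.
Proof.
apply: contrapT => nX; apply: X_C1.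
have hX := metrizable_hausdorff X_metrizable.
have [b bX] := metrizable_countable_base X_compact X_metrizable.
have [X0 sX] := splits_of_not_reconstructible hX X_compact X_not_two_points nX.
apply: (C1_dense_Gdelta_continuum hX X_compact bX _ X0) => [x|V oV V0].
  exact: splits_not_isolated (sX 1 x).
exact: (trisected_open_clopen hX X_compact bX (sX 3) oV V0).
Qed.
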